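(* Let $K$ be a field. Let $\mathcal A=\{a_m\}_{m=1}^\infty$ be a sequence of constants in $K$, and let $\mathcal T=\{t_m(q)\}_{m=1}^\infty$, $\mathcal U=\{u_m(q)\}_{m=1}^\infty$, $\mathcal V=\{v_m(q)\}_{m=1}^\infty$ be sequences of polynomials in $K[q]$. Then \[ [m+n+k]_q = a_m [m]_q + t_m(q)[n]_q + u_m(q)[k]_q + v_m(q)[n]_q[k]_q \] holds for all positive integers $m,n,k$ (that is, $\oplus_{\mathcal A,\mathcal T,\mathcal U,\mathcal V}$ is the first kind of quadratic addition rule for three $q$-integers) if and only if $a_m=1$, $t_m(q)=u_m(q)=q^m$, and $v_m(q)=q^m(q-1)$ for all positive integers $m$.
   Context: For a positive integer $n$, the $q$-integer is the polynomial $[n]_q = 1+q+q^2+\dots+q^{n-1}$ in the indeterminate $q$. For sequences of polynomials $\mathcal S=\{s_m(q)\}$, $\mathcal T=\{t_m(q)\}$, $\mathcal U=\{u_m(q)\}$, $\mathcal V=\{v_m(q)\}$ (indexed by $m\ge 1$), define $\oplus_{\mathcal S,\mathcal T,\mathcal U,\mathcal V}([m]_q,[n]_q,[k]_q)=s_m(q)[m]_q+t_m(q)[n]_q+u_m(q)[k]_q+v_m(q)[n]_q[k]_q$. This is called the first kind of quadratic addition rule for three $q$-integers if it equals $[m+n+k]_q$ for all positive integers $m,n,k$. Equalities are equalities of polynomials in $K[q]$. *)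

(* Defs.v *)
From mathcomp Require Import all_boot all_algebra.

Set Implicit Arguments.
Unset Strict Implicit.
Unset Printing Implicit Defensive.

Import GRing.Theory.
Local Open Scope ring_scope.

(* The indeterminate q is 'X. *)
Definition qint (K : fieldType) (n : nat) : {poly K} := \sum_(i < n) 'X^i.

(* Sequences indexed by m >= 1 are functions on nat; their value at 0 is never
   constrained or used.  The operation depends on the indices m, n, k, not
   only on the three polynomials [m]_q, [n]_q, [k]_q. *)
Definition oplus (K : fieldType) (s t u v : nat -> {poly K}) (m n k : nat) :
    {poly K} :=
  s m * qint K m + t m * qint K n + u m * qint K k
    + v m * qint K n * qint K k.

Definition quadratic_addition_rule1 (K : fieldType)
    (s t u v : nat -> {poly K}) : Prop :=
  forall m n k : nat, (0 < m)%N -> (0 < n)%N -> (0 < k)%N ->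
    oplus s t u v m n k = qint K (m + n + k).

(* Main.v *)
(** Both [m+n+k]_q and the rule are affine
    in each of [n]_q and [k]_q, so for fixed m their difference is
    A + T [n]_q + U [k]_q + V [n]_q [k]_q.  Its vanishing at n, k in {1, 2},
    where [1]_q = 1 and [2]_q = 1 + q, forces A = T = U = V = 0. *)
Require Import Defs.
From mathcomp Require Import all_boot all_algebra.
From mathcomp Require Import ring.

Set Implicit Arguments.
Unset Strict Implicit.
Unset Printing Implicit Defensive.

Import GRing.Theory.
Local Open Scope ring_scope.

Lemma qintD (K : fieldType) (m n : nat) :
  qint K (m + n) = qint K m + 'X^m * qint K n.
Proof.
rewrite /qint big_split_ord /= mulr_sumr; congr (_ + _).
by apply: eq_bigr => i _; rewrite exprD.
Qed.

Lemma qint_geometric (K : fieldType) (n : nat) :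
  ('X - 1) * qint K n = 'X^n - 1.
Proof. by rewrite subrX1. Qed.

Lemma qint1 (K : fieldType) : qint K 1 = 1.
Proof. by rewrite /qint big_ord1 expr0. Qed.

Lemma qint2 (K : fieldType) : qint K 2 = 1 + 'X.
Proof. by rewrite (qintD K 1 1) qint1 expr1 mulr1. Qed.

(** Multiplying by q - 1 gives q^n - 1, which is monic. Evaluating at q = 1 would not do, since n
    may vanish in K. *)
Lemma qint_neq0 (K : fieldType) (n : nat) : (0 < n)%N -> qint K n != 0.
Proof.
move=> n_gt0; apply: contraTneq (monicXnsubC (1 : K) n_gt0) => n0.
by rewrite polyC1 -qint_geometric n0 mulr0 monicE lead_coef0 eq_sym oner_eq0.
Qed.

(** Splitting the sum twice leaves q^(m+n) as the coefficient of [k]_q; substituting q^n = 1 + (q -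
    1)[n]_q there produces the quadratic term. *)
Lemma qintD3 (K : fieldType) (m n k : nat) :
  qint K (m + n + k) = qint K m + 'X^m * qint K n + 'X^m * qint K k
    + 'X^m * ('X - 1) * qint K n * qint K k.
Proof.
have -> : 'X^m * ('X - 1) * qint K n * qint K k
          = 'X^m * (('X - 1) * qint K n) * qint K k by rewrite !mulrA.
by rewrite qint_geometric !qintD exprD; ring.
Qed.

Lemma biaffine_eq0 (R : idomainType) (x a b c d : R) : x != 0 ->
    (forall y z, y \in [:: 1; 1 + x] -> z \in [:: 1; 1 + x] ->
      a + b * y + c * z + d * y * z = 0) ->
  [/\ a = 0, b = 0, c = 0 & d = 0].
Proof.
move=> x_neq0 E.
have x0 e : e * x = 0 -> e = 0.
  by move/eqP; rewrite mulf_eq0 (negPf x_neq0) orbF => /eqP.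
pose p y z := a + b * y + c * z + d * y * z.
have [one_in xp1_in] : 1 \in [:: 1; 1 + x] /\ 1 + x \in [:: 1; 1 + x].
  by rewrite !mem_seq2 !eqxx orbT.
have E11 : p 1 1 = 0 by exact: E.
have E12 : p 1 (1 + x) = 0 by exact: E.
have E21 : p (1 + x) 1 = 0 by exact: E.
have E22 : p (1 + x) (1 + x) = 0 by exact: E.
(* The mixed second difference of [p] with step [x] in both variables kills the terms in [a], [b],
   [c] and leaves d x^2. *)
have d0 : d = 0.
  apply: (x0); apply: (x0).
  have -> : d * x * x = p (1 + x) (1 + x) - p (1 + x) 1 - p 1 (1 + x) + p 1 1.
    by rewrite /p; ring.
  by rewrite E11 E12 E21 E22 !subr0 addr0.
(* The first difference in [y] at z = 1 is (b + d) x; the one in [z] at y = 1 is (c + d) x. *)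
have b0 : b = 0.
  apply: (x0); have -> : b * x = p (1 + x) 1 - p 1 1 - d * x by rewrite /p; ring.
  by rewrite E11 E21 d0 mul0r !subr0.
have c0 : c = 0.
  apply: (x0); have -> : c * x = p 1 (1 + x) - p 1 1 - d * x by rewrite /p; ring.
  by rewrite E11 E12 d0 mul0r !subr0.
by split=> //; rewrite -E11 /p b0 c0 d0 !mul0r !addr0.
Qed.

Theorem theorem1 (K : fieldType) (a : nat -> K) (t u v : nat -> {poly K}) :
  quadratic_addition_rule1 (fun m => (a m)%:P) t u v <->
  (forall m : nat, (0 < m)%N ->
    [/\ a m = 1, t m = 'X^m, u m = 'X^m & v m = 'X^m * ('X - 1)]).
Proof.
split=> [rule m m_gt0 | coefs m n k m_gt0 _ _]; last first.
  by rewrite /oplus; have [-> -> -> ->] := coefs m m_gt0; rewrite mul1r qintD3.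
(* These are the coefficients of the rule minus the expansion [qintD3]; the term in [m]_q does not
   involve n or k, so it is the constant one. *)
have [||A0 T0 U0 V0] := @biaffine_eq0 {poly K} 'X
  (((a m)%:P - 1) * qint K m) (t m - 'X^m) (u m - 'X^m)
  (v m - 'X^m * ('X - 1)); first by rewrite polyX_eq0.
  have qint12 y : y \in [:: 1; 1 + 'X] -> exists2 n, (0 < n)%N & y = qint K n.
    rewrite mem_seq2 => /orP[] /eqP->; first by exists 1%N; rewrite ?qint1.
    by exists 2%N; rewrite ?qint2.
  move=> _ _ /qint12[n n_gt0 ->] /qint12[k k_gt0 ->].
  have /eqP := rule m n k m_gt0 n_gt0 k_gt0.
  rewrite qintD3 /oplus -subr_eq0 => /eqP E; rewrite -[RHS]E; ring.
split; [|exact/subr0_eq..].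
(* Since [m]_q is nonzero it cancels from (a_m - 1)[m]_q = 0, and the equality of constant
   polynomials descends to K. *)
move/eqP: A0; rewrite mulf_eq0 (negPf (qint_neq0 K m_gt0)) orbF subr_eq0.
by move/eqP/polyC_inj.
Qed.
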